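(* Fix $b\ge2$ and $\omega>0$, and let $\lambda=\omega(1+\omega)^b$. Suppose that $A$ is an effective reconstruction algorithm for the broadcasting model. Then the relaxation time $T_{\rm relax}$ of the Glauber dynamics for the broadcasting model on $T_h$ satisfies, as $h\to\infty$, $$T_{\rm relax}=\Omega\left((\bar S_A)^{-1}\right).$$
   Context: $T_h$ is the complete rooted tree of height $h$ in which every non-leaf vertex has $b$ children; $r$ is the root, $V$ the vertex set, $n=|V|$, $L$ the set of leaves. Independent sets $\sigma$ are identified with elements of $\{0,1\}^V$; $\sigma_h$ is the restriction of $\sigma$ to $L$. Broadcasting model: the probability measure $\nu_h$ on the independent sets of $T_h$ with $\nu_h(\sigma)\propto\lambda^{|\sigma\cap(V\setminus L)|}\omega^{|\sigma\cap L|}$. Its (heat-bath) Glauber dynamics chooses in each step a uniformly random $v\in V$, leaves all other vertices unchanged, and if all neighbours of $v$ are unoccupied sets $v$ occupied with probability $\alpha_v/(1+\alpha_v)$ and unoccupied otherwise, where $\alpha_v=\lambda$ for $v\notin L$ and $\alpha_v=\omega$ for $v\in L$; if some neighbour of $v$ is occupied, $v$ is set unoccupied. The relaxation time is $1/(1-\gamma)$, where $\gamma$ is the second largest absolute value of an eigenvalue of the transition matrix. A reconstruction algorithm is (for each $h$) a function $A$ from configurations in $\{0,1\}^L$ to $\{0,1\}$; write $A(\sigma)=A(\sigma_h)$. Its effectiveness is $$r_{h,A}=\min_{x\in\{0,1\}}\left[\nu_h(A(\sigma)=\sigma(r)=x)-\nu_h(A(\sigma)=x)\,\nu_h(\sigma(r)=x)\right],$$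 and $A$ is effective if $\liminf_{h\to\infty}r_{h,A}=c_0>0$ for a constant $c_0$ depending only on $\omega$ and $b$. For $v\in L$ let $\sigma^v$ be $\sigma$ with the value at $v$ flipped. The sensitivity is $S_A(\sigma)=\frac1n\#\{v\in L: A(\sigma^v)\neq A(\sigma)\}$ and the average sensitivity is $\bar S_A=\mathrm{E}_{\sigma\sim\nu_h}\left[S_A(\sigma)\mathbf 1(A(\sigma)=1)\right]$. The constant hidden in $\Omega$ may depend on $\omega,b$ and $A$ but not on $h$. *)

(* Defs.v *)
From HB Require Import structures.
From mathcomp Require Import all_boot all_order all_algebra.
From mathcomp Require Import complex.
From mathcomp Require Import all_classical all_reals all_analysis.

Set Implicit Arguments.
Unset Strict Implicit.
Unset Printing Implicit Defensive.

Import Order.TTheory GRing.Theory Num.Theory.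
Import numFieldNormedType.Exports.

Local Open Scope ring_scope.

(* A vertex of T_h is the path leading to it from the root, most recent step
   first: the root is [::], the children of u are i :: u for i : 'I_b, and the
   depth of u is size u, at most h. *)
Definition vertex (b h : nat) : finType := {bseq h of 'I_b}.

Definition tree_root (b h : nat) : vertex b h := [bseq].

Definition is_child (b h : nat) (u v : vertex b h) : bool :=
  [exists i : 'I_b, v == i :: u :> seq 'I_b].

Definition adj (b h : nat) : rel (vertex b h) :=
  [rel u v | is_child u v || is_child v u].

Definition is_leaf (b h : nat) (v : vertex b h) : bool := size v == h.

Definition config (b h : nat) : finType := {ffun vertex b h -> bool}.

Definition independent (b h : nat) (sigma : config b h) : bool :=
  [forall u, forall v, adj u v ==> ~~ (sigma u && sigma v)].

Definition indset (b h : nat) : finType :=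
  {sigma : config b h | independent sigma}.

Definition set_at (b h : nat) (sigma : config b h) (v : vertex b h) (x : bool) :
    config b h :=
  [ffun u => if u == v then x else sigma u].

Definition flip (b h : nat) (sigma : config b h) (v : vertex b h) : config b h :=
  set_at sigma v (~~ sigma v).

Definition leaf (b h : nat) : finType := {v : vertex b h | is_leaf v}.

Definition leaf_config (b h : nat) : finType := {ffun leaf b h -> bool}.

Definition leaf_restrict (b h : nat) (sigma : config b h) : leaf_config b h :=
  [ffun v => sigma (val v)].

Definition weight (R : realType) (b h : nat) (lambda omega : R)
    (sigma : config b h) : R :=
  lambda ^+ #|[set v | sigma v & ~~ is_leaf v]| *
  omega ^+ #|[set v | sigma v & is_leaf v]|.

Definition nu (R : realType) (b h : nat) (lambda omega : R)
    (sigma : indset b h) : R :=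
  weight lambda omega (val sigma) /
  \sum_(tau : indset b h) weight lambda omega (val tau).

Definition nu_prob (R : realType) (b h : nat) (lambda omega : R)
    (E : pred (config b h)) : R :=
  \sum_(sigma : indset b h | E (val sigma)) nu lambda omega sigma.

Definition nu_expect (R : realType) (b h : nat) (lambda omega : R)
    (f : config b h -> R) : R :=
  \sum_(sigma : indset b h) nu lambda omega sigma * f (val sigma).

Definition activity (R : realType) (b h : nat) (lambda omega : R)
    (v : vertex b h) : R :=
  if is_leaf v then omega else lambda.

(* Probability that the update at v makes v occupied. *)
Definition occupy_prob (R : realType) (b h : nat) (lambda omega : R)
    (sigma : config b h) (v : vertex b h) : R :=
  if [forall u, adj u v ==> ~~ sigma u]
  then activity lambda omega v / (1 + activity lambda omega v)
  else 0.

Definition glauber (R : realType) (b h : nat) (lambda omega : R)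
    (sigma tau : config b h) : R :=
  #|vertex b h|%:R^-1 *
  \sum_(v : vertex b h)
    (occupy_prob lambda omega sigma v * (tau == set_at sigma v true)%:R +
     (1 - occupy_prob lambda omega sigma v) *
       (tau == set_at sigma v false)%:R).

Definition glauber_mx (R : realType) (b h : nat) (lambda omega : R) :
    'M[R]_#|indset b h| :=
  \matrix_(i, j) glauber lambda omega (val (enum_val i)) (val (enum_val j)).

(* The complex eigenvalues, listed with algebraic multiplicity. *)
Definition eigenvalues (R : realType) (n : nat) (P : 'M[R]_n) : seq R[i] :=
  sval (closed_field_poly_normal (char_poly (map_mx (real_complex R) P))).

(* Moduli are sorted in decreasing order; index 1 is the second largest. *)
Definition second_eigenvalue (R : realType) (n : nat) (P : 'M[R]_n) : R :=
  nth 0 (sort >=%R [seq ComplexField.Normc.normc z | z <- eigenvalues P]) 1.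

Definition relaxation_time (R : realType) (b h : nat) (lambda omega : R) : R :=
  (1 - second_eigenvalue (glauber_mx b h lambda omega))^-1.

Definition reconstruction (b : nat) : Type :=
  forall h : nat, leaf_config b h -> bool.

Definition correlation (R : realType) (b h : nat) (lambda omega : R)
    (A : reconstruction b) (x : bool) : R :=
  nu_prob lambda omega
    [pred sigma | (A h (leaf_restrict sigma) == x) && (sigma (tree_root b h) == x)] -
  nu_prob lambda omega [pred sigma | A h (leaf_restrict sigma) == x] *
  nu_prob lambda omega [pred sigma : config b h | sigma (tree_root b h) == x].

Definition effectiveness (R : realType) (b h : nat) (lambda omega : R)
    (A : reconstruction b) : R :=
  Num.min (correlation h lambda omega A false) (correlation h lambda omega A true).

Definition effective (R : realType) (b : nat) (lambda omega : R)
    (A : reconstruction b) : Prop :=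
  exists2 c0 : R, 0 < c0 &
    limn_einf (fun h => (effectiveness h lambda omega A)%:E) = c0%:E.

Definition sensitivity (R : realType) (b h : nat) (A : reconstruction b)
    (sigma : config b h) : R :=
  #|[set v : vertex b h |
      is_leaf v & A h (leaf_restrict (flip sigma v)) != A h (leaf_restrict sigma)]|%:R /
  #|vertex b h|%:R.

Definition average_sensitivity (R : realType) (b h : nat) (lambda omega : R)
    (A : reconstruction b) : R :=
  nu_expect lambda omega
    (fun sigma : config b h =>
       sensitivity R A sigma * (A h (leaf_restrict sigma))%:R).

(* Main.v *)
Require Import Defs.
From HB Require Import structures.
From mathcomp Require Import all_boot all_order all_algebra.
From mathcomp Require Import complex spectral.
From mathcomp Require Import all_classical all_reals all_analysis.
From mathcomp Require Import ring.

Set Implicit Arguments.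
Unset Strict Implicit.
Unset Printing Implicit Defensive.

Import Order.TTheory GRing.Theory Num.Theory.
Import numFieldNormedType.Exports.

Local Open Scope ring_scope.
Local Open Scope classical_set_scope.

(** An event of moderate probability that is hard to leave makes the chain slow;
    here it is the event that the algorithm answers 1.  Let [B] be the set of independent sets [sigma]
    with [A sigma = 1] and let [q] be its probability.  Glauber dynamics changes
    one vertex at a time and [A] reads only the leaves, so a step can leave [B]
    only by flipping a leaf [v] with [A (sigma^v) <> A sigma]; the vertex [v] is
    selected with probability [1/n], so the stationary flow out of [B] is at most
    the average sensitivity ([escape_le_sensitivity]).

    On the other side, the chain is reversible for [nu], so its transition matrix
    is similar to a real symmetric one and has an orthonormal eigenbasis
    ([reversible_eigenbasis]).  Expanding the centered indicator
    [f = 1_B - q] in that basis compares its Dirichlet form, which is exactly the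
    flow out of [B], with its variance [q (1 - q)]:
    [(1 - gamma) q (1 - q) <= flow] ([spectral_gap], [conductance_bound]).
    A correlation with the root is at most the probability of the corresponding
    answer, so effectiveness with constant [c] forces [q >= c] and [1 - q >= c]
    ([effectiveness_variance]).  Hence [(1 - gamma) c^2] is at most the average
    sensitivity for all large [h].

    To invert this inequality one needs [gamma < 1]; it also gives that the
    average sensitivity is eventually positive.  A complex eigenvector for an
    eigenvalue of modulus at least 1 is constant by the maximum principle
    ([eigenvector_constant]), because every independent set stays unchanged with
    positive probability and can be emptied vertex by vertex.  Two members of an
    orthonormal basis cannot both be constant, so exactly one eigenvalue, counted
    with multiplicity, has modulus at least 1. *)

(** * The second largest entry of a finite family *)

Lemma count_gt_second_largest (R : realType) (s : seq R) :
  (count (fun y => nth 0 (sort >=%R s) 1 < y)%R s <= 1)%N.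
Proof.
rewrite -(count_sort >=%R).
have : sorted >=%R (sort >=%R s) by apply: sort_sorted => x y; apply: le_total.
case: (sort _ s) => [|x [|y t]] //=; first by rewrite addn0 leq_b1.
move=> /andP[_ yt]; rewrite ltxx add0n.
suff /eqP -> : count (fun z => y < z) t == 0%N by rewrite addn0 leq_b1.
rewrite -leqn0 leqNgt -has_count; apply/hasPn => z zt; rewrite -leNgt.
by move: yt; rewrite (path_sortedE (rev_trans le_trans)) => /andP[/allP/(_ z zt)].
Qed.

(** The bound [0 < c] covers lists with fewer than two entries, for which the
    second largest entry is the default value 0. *)
Lemma second_largest_lt (R : realType) (s : seq R) (c : R) : 0 < c ->
  (count (fun y => c <= y)%R s <= 1)%N -> nth 0 (sort >=%R s) 1 < c.
Proof.
move=> c0; rewrite -(count_sort >=%R) => cs; rewrite ltNge; apply/negP => cle.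
have : sorted >=%R (sort >=%R s) by apply: sort_sorted => x y; apply: le_total.
move: cs cle; case: (sort _ s) => [|x [|y t]] //=.
- by rewrite leNgt c0.
- by rewrite leNgt c0.
move=> cs cy /andP[yx _]; move: cs; rewrite cy (le_trans cy yx) => //.
Qed.

Lemma count_image_le1 (I : finType) (T : Type) (p : pred T) (F : I -> T) :
  (count p [seq F i | i : I] <= 1)%N <-> (forall i j, p (F i) -> p (F j) -> i = j).
Proof.
have -> : count p [seq F i | i : I] = #|[pred i | p (F i)]|.
  by rewrite /image_mem count_map enumT -size_filter cardE.
split=> [/card_le1_eqP h i j pi pj|h]; first exact: h.
by apply/card_le1_eqP => i j; rewrite !inE => pi pj; apply: h.
Qed.

(** * Spectrum of a reversible matrix *)

Lemma char_poly_similar (F : fieldType) (n : nat) (V A B : 'M[F]_n) :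
  V \in unitmx -> V *m A = B *m V -> char_poly A = char_poly B.
Proof.
move=> Vu VA; have e : map_mx polyC V *m char_poly_mx A = char_poly_mx B *m map_mx polyC V.
  by rewrite /char_poly_mx mulmxBr mulmxBl -!map_mxM VA scalar_mxC.
have : \det (map_mx (@polyC F) V) != 0.
  by rewrite det_map_mx polyC_eq0 -unitfE -unitmxE.
by move/mulfI; apply; rewrite /char_poly -det_mulmx e det_mulmx mulrC.
Qed.

Section ReversibleSpectrum.
Variables (R : realType) (n : nat) (P : 'M[R]_n) (pi : 'I_n -> R).
Hypothesis pi_gt0 : forall i, 0 < pi i.
Hypothesis P_rev : forall i j, pi i * P i j = pi j * P j i.

Local Notation toC := (real_complex R).
Local Notation s i := (Num.sqrt (pi i)).

Let s_neq0 i : s i != 0. Proof. by rewrite gt_eqF ?sqrtr_gt0. Qed.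
Let sK i : s i * s i = pi i. Proof. by rewrite -expr2 sqr_sqrtr ?ltW. Qed.
Let sC_neq0 i : toC (s i) != 0. Proof. by rewrite fmorph_eq0. Qed.
Let toC_real (x : R) : toC x \is Num.real.
Proof. by apply/complex_realP; exists x. Qed.

Let conjugate_sym i j : s j * P j i / s i = s i * P i j / s j.
Proof.
have h : s j * s j * P j i = s i * s i * P i j by rewrite !sK P_rev.
have si := s_neq0 i; have sj := s_neq0 j.
apply: (mulIf si); apply: (mulIf sj).
transitivity (s j * s j * P j i); first by field.
by rewrite h; field.
Qed.

(** Detailed balance makes this conjugate of [P] by the diagonal matrix of the
    [sqrt (pi i)] symmetric; the entries are embedded in the complex numbers
    because the spectral theorem is stated there. *)
Definition symmetrization : 'M[R[i]]_n :=
  \matrix_(i, j) toC (s i * P i j / s j).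

Lemma symmetrization_hermitian : symmetrization \is hermsymmx.
Proof.
apply: realsym_hermsym.
  apply/is_hermitianmxP; rewrite expr0 scale1r; apply/matrixP => i j.
  by rewrite !mxE conjugate_sym.
by apply/mxOverP => i j; rewrite mxE toC_real.
Qed.

(** Row [k] of [U] is a unit eigenvector of the symmetrization; dividing its
    entries by [sqrt (pi j)] turns it into a right eigenvector of [P].  Keeping
    [U] itself, and not the eigenvectors of [P], leaves orthonormality with
    respect to [pi] as plain unitarity. *)
Lemma reversible_eigenbasis :
  exists (d : 'I_n -> R) (U : 'M[R[i]]_n),
    [/\ U \is unitarymx,
        forall k i, \sum_j toC (P i j) * (U k j / toC (s j)) =
                    toC (d k) * (U k i / toC (s i)) &
        char_poly (map_mx toC P) = \prod_k ('X - (toC (d k))%:P)].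
Proof.
set S := symmetrization; set U := spectralmx S.
have S_herm := symmetrization_hermitian.
have /mxOverP d_real := hermitian_spectral_diag_real S_herm.
pose d k := complex.Re (spectral_diag S 0 k).
have dE k : spectral_diag S 0 k = toC (d k).
  by have /complex_realP[x e] := d_real 0 k; rewrite /d e.
have US : U *m S = diag_mx (spectral_diag S) *m U.
  have /orthomx_spectralP SE := hermitian_normalmx S_herm.
  rewrite {1}/S SE.
  by rewrite !mulmxA mulmxV ?spectral_unit // mul1mx.
exists d, U; split; first exact: spectral_unitarymx.
  move=> k i; have /matrixP/(_ k i) := US.
  rewrite mul_diag_mx !mxE dE => e; rewrite mulrA -e mulr_suml.
  apply: eq_bigr => j _; rewrite mxE.
  rewrite conjugate_sym.
  rewrite !rmorphM /= fmorphV; have := sC_neq0 i; have := sC_neq0 j => *.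
  by field; apply/andP.
(* The rows of [U *m Ds] are left eigenvectors of [P], so this matrix
   diagonalizes [P] and determines its characteristic polynomial. *)
pose Ds := diag_mx (\row_i toC (s i)).
have Ds_unit : Ds \in unitmx.
  rewrite unitmxE det_diag unitfE; apply/prodf_neq0 => i _.
  by rewrite mxE sC_neq0.
have V : (U *m Ds) *m map_mx toC P = diag_mx (spectral_diag S) *m (U *m Ds).
  rewrite mulmxA -US -!mulmxA; congr (_ *m _); apply/matrixP => i j.
  rewrite mul_diag_mx mul_mx_diag !mxE !rmorphM /= fmorphV.
  by rewrite mulfVK ?sC_neq0.
rewrite (char_poly_similar _ V) ?unitmx_mul ?spectral_unit //.
rewrite char_poly_trig ?diag_mx_is_trig //.
by apply: eq_bigr => k _; rewrite mxE eqxx mulr1n dE.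
Qed.

Lemma second_eigenvalue_moduli (d : 'I_n -> R) :
  char_poly (map_mx toC P) = \prod_k ('X - (toC (d k))%:P) ->
  second_eigenvalue P = nth 0 (sort >=%R [seq `|d k| | k : 'I_n]) 1.
Proof.
move=> dP; rewrite /second_eigenvalue /eigenvalues.
case: closed_field_poly_normal => e /= eP; congr (nth _ _ _).
apply/perm_sortP; [exact: ge_total | exact: ge_trans | exact: ge_anti |].
have -> : [seq `|d k| | k : 'I_n] =
    [seq ComplexField.Normc.normc z | z <- [seq toC (d k) | k : 'I_n]].
  rewrite -map_comp; apply: eq_map => k /=.
  by rewrite expr0n addr0 sqrtr_sqr.
apply: perm_map; apply: prod_XsubC_eq.
move: eP; rewrite (monicP (char_poly_monic _)) scale1r => <-.
by rewrite dP big_image.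
Qed.
End ReversibleSpectrum.

(** * Eigenvectors of modulus at least one are constant *)

Section StochasticMatrix.
Variables (R : realType) (n : nat) (P : 'M[R]_n).
Hypothesis P_ge0 : forall i j, 0 <= P i j.
Hypothesis P_sum1 : forall i, \sum_j P i j = 1.

Local Notation toC := (real_complex R).

(** At a point of maximal modulus the eigenvalue equation divided by [z * g k]
    writes 1 as an average of numbers of modulus at most 1, so each of those
    that carries mass equals 1. *)
Lemma eigenvector_at_max (z : R[i]) (g : 'I_n -> R[i]) (k : 'I_n) :
  1 <= `|z| -> (forall i, \sum_j toC (P i j) * g j = z * g i) ->
  (forall j, `|g j| <= `|g k|) -> g k != 0 ->
  forall j, 0 < P k j -> g j = z * g k.
Proof.
move=> z1 gz gmax gk0 j Pkj.
have z0 : z != 0 by rewrite -normr_gt0 (lt_le_trans _ z1).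
have zg0 : z * g k != 0 by rewrite mulf_neq0.
suff: toC (P k j) * g j / (z * g k) = toC (P k j).
  move=> e; have P0 : toC (P k j) != 0 by rewrite fmorph_eq0 gt_eqF.
  apply: (mulfI P0); rewrite -{2}e.
  by rewrite mulfVK.
apply: (@normC_sum_upper _ _ xpredT (fun j => toC (P k j) * g j / (z * g k))
  (fun j => toC (P k j))) => // [i _|].
  rewrite !normrM normfV normrM -mulrA ger0_norm ?lecR ?P_ge0 //.
  rewrite ler_piMr ?lecR ?P_ge0 // ler_pdivrMr ?mulr_gt0 ?normr_gt0 // mul1r.
  by rewrite (le_trans (gmax i)) // ler_peMl.
by rewrite -mulr_suml gz divff // -rmorph_sum /= P_sum1.
Qed.

Lemma exists_max_norm (g : 'I_n -> R[i]) (i : 'I_n) :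
  exists k, forall j, `|g j| <= `|g k|.
Proof.
pose F j := ComplexField.Normc.normc (g j).
exists [arg max_(k > i) F k]%O => j.
case: Order.TotalTheory.arg_maxP => // k _ /(_ j isT) Fjk.
by have : toC (F j) <= toC (F k) by rewrite lecR.
Qed.

(** Self-loops force the eigenvalue 1.  The value at a maximum then propagates
    along positive transitions to [o].  Applied to [g - g o], which is again an
    eigenvector and vanishes at [o], this shows that [g] is constant; so paths
    towards a single state [o] suffice. *)
Lemma eigenvector_constant (o : 'I_n) (z : R[i]) (g : 'I_n -> R[i]) :
  (forall i, 0 < P i i) -> (forall i, connect [rel i j | 0 < P i j] i o) ->
  1 <= `|z| -> (forall i, \sum_j toC (P i j) * g j = z * g i) ->
  forall i j, g i = g j.
Proof.
move=> P_diag P_conn z1 gz.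
have max_o (w : R[i]) (f : 'I_n -> R[i]) k : 1 <= `|w| ->
    (forall i, \sum_j toC (P i j) * f j = w * f i) ->
    (forall j, `|f j| <= `|f k|) -> f k != 0 -> w = 1 /\ f o = f k.
  move=> w1 fw fmax fk0.
  have w_eq1 : w = 1.
    have := eigenvector_at_max w1 fw fmax fk0 (P_diag k).
    by rewrite -{1}[f k]mul1r => /(mulIf fk0).
  split=> //; have /connectP[p pth ->] := P_conn k.
  elim: p k fmax fk0 pth => //= j p IH k fmax fk0 /andP[Pkj pth].
  have fjk : f j = f k.
    by rewrite (eigenvector_at_max w1 fw fmax fk0 Pkj) w_eq1 mul1r.
  by rewrite (IH j) // => [i|]; rewrite fjk.
have [g0|/existsNP[i0 gi0]] := pselect (forall i, g i = 0).
  by move=> i j; rewrite !g0.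
have z_eq1 : z = 1.
  have [k kmax] := exists_max_norm g i0.
  have gk0 : g k != 0.
    by rewrite -normr_gt0 (lt_le_trans _ (kmax i0)) // normr_gt0; apply/eqP.
  by have [] := max_o _ _ _ z1 gz kmax gk0.
suff h i : g i = g o by move=> i j; rewrite !h.
apply/eqP; rewrite -subr_eq0; apply/eqP.
pose f i := g i - g o; rewrite -/(f i).
have [k kmax] := exists_max_norm f i.
have fk0 : f k = 0.
  apply/eqP/negPn/negP => fk0.
  have fP l : \sum_j toC (P l j) * f j = 1 * f l.
    under eq_bigr do rewrite mulrBr.
    by rewrite sumrB gz -mulr_suml -rmorph_sum /= P_sum1 z_eq1 !mul1r.
  have [|_ fo] := max_o 1 f k _ fP kmax fk0; first by rewrite normr1.
  by move: fk0; rewrite -fo /f subrr eqxx.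
by apply/eqP; rewrite -normr_le0 (le_trans (kmax i)) // fk0 normr0.
Qed.
End StochasticMatrix.

(** * The variational bound on the spectral gap *)

Lemma unitary_dot (C : numClosedFieldType) (n : nat) (U : 'M[C]_n) (x y : 'cV[C]_n) :
  U \is unitarymx ->
  \sum_k ((U *m x) k 0)^* * (U *m y) k 0 = \sum_i (x i 0)^* * y i 0.
Proof.
move=> U_unit.
have dotE (a b : 'cV[C]_n) : \sum_i (a i 0)^* * b i 0 = (map_mx Num.conj a^T *m b) 0 0.
  by rewrite mxE; apply: eq_bigr => i _; rewrite !mxE.
rewrite !dotE trmx_mul map_mxM -mulmxA.
by rewrite [map_mx _ U^T *m _]mulmxA -invmx_unitary // mulVmx ?unitarymx_unit // mul1mx.
Qed.

Section SpectralGap.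
Variables (R : realType) (n : nat) (P : 'M[R]_n) (pi : 'I_n -> R) (o : 'I_n).
Hypothesis P_ge0 : forall i j, 0 <= P i j.
Hypothesis P_sum1 : forall i, \sum_j P i j = 1.
Hypothesis pi_gt0 : forall i, 0 < pi i.
Hypothesis P_rev : forall i j, pi i * P i j = pi j * P j i.
Hypothesis P_diag : forall i, 0 < P i i.
Hypothesis P_conn : forall i, connect [rel i j | 0 < P i j] i o.

Local Notation toC := (real_complex R).
Local Notation s i := (Num.sqrt (pi i)).
Local Notation gamma := (second_eigenvalue P).

(** Two eigenvectors of an orthonormal basis cannot both be multiples of the
    same vector, so at most one eigenvalue reaches modulus 1 and [gamma < 1].
    The eigenvalue 1 does occur, since constants are fixed, hence it is the only
    one whose modulus exceeds [gamma]; a function of mean zero has no component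
    along it. *)
Lemma spectral_gap :
  gamma < 1 /\
  forall f : 'I_n -> R, \sum_i pi i * f i = 0 ->
    \sum_i pi i * f i * (\sum_j P i j * f j) <= gamma * \sum_i pi i * f i ^+ 2.
Proof.
have [d [U [U_unit eigU cpP]]] := reversible_eigenbasis pi_gt0 P_rev.
have s_neq0 i : s i != 0 by rewrite gt_eqF ?sqrtr_gt0.
have sK i : s i * s i = pi i by rewrite -expr2 sqr_sqrtr ?ltW.
have piE i : toC (pi i) = toC (s i) * toC (s i) by rewrite -rmorphM /= sK.
have sC_neq0 i : toC (s i) != 0 by rewrite fmorph_eq0.
have conj_toC (x : R) : ((toC x)^*)%R = toC x.
  by apply/CrealP/complex_realP; exists x.
have normC_d k : 1 <= `|d k| -> 1 <= `|toC (d k)|.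
  by rewrite normc_def /= expr0n addr0 sqrtr_sqr lecR.
have U_const k : 1 <= `|d k| -> exists a, forall j, U k j = a * toC (s j).
  move=> /normC_d dk; have h := eigenvector_constant P_ge0 P_sum1 P_diag P_conn dk (eigU k).
  exists (U k o / toC (s o)) => j.
  by rewrite (h o j) mulfVK.
(* Constant eigenfunctions correspond to rows of [U] proportional to the vector
   of the [sqrt (pi j)], and distinct rows are orthogonal unit vectors. *)
have uniq1 k l : 1 <= `|d k| -> 1 <= `|d l| -> k = l.
  move=> /U_const[a ak] /U_const[b bl]; apply/eqP/negPn/negP => kl.
  have dotU k1 l1 : \sum_j U k1 j * (U l1 j)^* = (k1 == l1)%:R.
    have /unitarymxP/matrixP/(_ k1 l1) := U_unit.
    by rewrite !mxE => <-; apply: eq_bigr => j _; rewrite !mxE.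
  have e k1 l1 u v : (forall j, U k1 j = u * toC (s j)) ->
      (forall j, U l1 j = v * toC (s j)) ->
      u * v^* * \sum_j toC (pi j) = (k1 == l1)%:R.
    move=> ku lv; rewrite -dotU mulr_sumr; apply: eq_bigr => j _.
    by rewrite ku lv rmorphM /= conj_toC piE; ring.
  have := e _ _ _ _ ak ak; have := e _ _ _ _ bl bl; have := e _ _ _ _ ak bl.
  rewrite !eqxx (negbTE kl) => /eqP; rewrite !mulf_eq0 conjC_eq0.
  move=> /orP[/orP[]|] /eqP ->; rewrite ?(mul0r, mulr0) => h1 h2.
  - by move/eqP: h2; rewrite eq_sym oner_eq0.
  - by move/eqP: h1; rewrite eq_sym oner_eq0.
  - by move/eqP: h1; rewrite eq_sym oner_eq0.
have gammaE := second_eigenvalue_moduli cpP.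
have gamma_lt1 : gamma < 1.
  by rewrite gammaE second_largest_lt //; apply/count_image_le1.
split=> // f f0.
have uniq_gamma k l : gamma < `|d k| -> gamma < `|d l| -> k = l.
  rewrite gammaE; have /count_image_le1 := count_gt_second_largest [seq `|d k| | k : 'I_n].
  exact.
pose F : 'cV[R[i]]_n := \col_i toC (s i * f i).
pose Y : 'cV[R[i]]_n := \col_i toC (s i * \sum_j P i j * f j).
pose S : 'cV[R[i]]_n := \col_i toC (s i).
(* Detailed balance moves [P] from the function onto the eigenvectors. *)
have UP (h : 'I_n -> R) k :
    (U *m \col_i toC (s i * \sum_j P i j * h j)) k 0 =
    toC (d k) * (U *m \col_i toC (s i * h i)) k 0.
  rewrite !mxE mulr_sumr.
  transitivity (\sum_j toC (h j) * toC (pi j) * \sum_i toC (P j i) * (U k i / toC (s i))).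
    under eq_bigr do rewrite mxE rmorphM rmorph_sum /= mulrA mulr_sumr.
    rewrite exchange_big; apply: eq_bigr => j _; rewrite mulr_sumr.
    apply: eq_bigr => i _.
    have : toC (pi j) * toC (P j i) = toC (s i) * toC (s i) * toC (P i j).
      by rewrite -piE -!rmorphM /= P_rev.
    rewrite rmorphM /= => e.
    transitivity (toC (h j) * (U k i / toC (s i)) * (toC (pi j) * toC (P j i))); last by ring.
    by rewrite e; have si := sC_neq0 i; field.
  apply: eq_bigr => j _; rewrite eigU mxE rmorphM /= piE.
  by have sj := sC_neq0 j; field.
(* Otherwise all coordinates of the constant function 1 would vanish. *)
have d1 : exists k, d k = 1.
  apply/not_existsP => dn1.
  have : U *m S = 0.
    apply/matrixP => k l; rewrite ord1 [RHS]mxE {l}.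
    have := UP (fun=> 1) k.
    have -> : (\col_i toC (s i * \sum_j P i j * 1)) = S.
      by apply/colP => i; rewrite !mxE -mulr_suml P_sum1 !mulr1.
    have -> : (\col_i toC (s i * 1)) = S by apply/colP => i; rewrite !mxE mulr1.
    move/eqP; rewrite -subr_eq0 -{1}[(U *m S) k 0]mul1r -mulrBl mulf_eq0.
    case/orP => /eqP // e; case: (dn1 k); apply/eqP.
    by move/eqP: e; rewrite subr_eq0 -(rmorph1 toC) => /eqP/complexI ->.
  move/(congr1 (mulmx (invmx U))); rewrite mulKmx ?unitarymx_unit // mulmx0.
  by move/colP/(_ o); rewrite !mxE => /eqP; apply/negP.
have c_eq0 k : gamma < `|d k| -> (U *m F) k 0 = 0.
  move=> dk; have [k1 dk1] := d1.
  have ek : k = k1 by apply: uniq_gamma; rewrite // dk1 normr1.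
  have [|a aU] := U_const k; first by rewrite ek dk1 normr1.
  rewrite mxE (eq_bigr (fun j => a * toC (pi j * f j))).
    by rewrite -mulr_sumr -rmorph_sum /= f0 rmorph0 mulr0.
  by move=> j _; rewrite aU mxE !rmorphM /= piE; ring.
rewrite -lecR rmorphM /= !rmorph_sum /=.
have -> : \sum_i toC (pi i * f i * \sum_j P i j * f j) = \sum_k toC (d k) * `|(U *m F) k 0| ^+ 2.
  transitivity (\sum_i (F i 0)^* * Y i 0).
    by apply: eq_bigr => i _; rewrite !mxE conj_toC ?expr2 !rmorphM /= piE; ring.
  rewrite -(unitary_dot _ _ U_unit); apply: eq_bigr => k _.
  by rewrite (UP f) normCKC; ring.
have -> : \sum_i toC (pi i * f i ^+ 2) = \sum_k `|(U *m F) k 0| ^+ 2.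
  transitivity (\sum_i (F i 0)^* * F i 0).
    by apply: eq_bigr => i _; rewrite !mxE conj_toC ?expr2 !rmorphM /= piE; ring.
  rewrite -(unitary_dot _ _ U_unit); apply: eq_bigr => k _.
  by rewrite normCKC.
rewrite mulr_sumr; apply: ler_sum => k _.
have [dk|/c_eq0 ->] := leP `|d k| gamma; last by rewrite normr0 expr0n !mulr0.
by rewrite ler_wpM2r ?exprn_ge0 // lecR (le_trans (ler_norm _)).
Qed.
End SpectralGap.

(** * The flow out of a set bounds the gap *)

Section Bottleneck.
Variables (R : realType) (n : nat) (P : 'M[R]_n) (pi : 'I_n -> R).
Hypothesis P_sum1 : forall i, \sum_j P i j = 1.
Hypothesis pi_sum1 : \sum_i pi i = 1.
Hypothesis P_rev : forall i j, pi i * P i j = pi j * P j i.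
Variable B : pred 'I_n.

Local Notation q := (\sum_(i | B i) pi i).
Local Notation f i := ((B i)%:R - q).

Let sum_indicator : \sum_i pi i * (B i)%:R = q.
Proof. by rewrite [RHS]big_mkcond; apply: eq_bigr => i _; case: (B i); rewrite ?mulr1 ?mulr0. Qed.

Lemma centered_indicator_mean : \sum_i pi i * f i = 0.
Proof.
under eq_bigr do rewrite mulrBr.
by rewrite sumrB sum_indicator -mulr_suml pi_sum1 mul1r subrr.
Qed.

Lemma centered_indicator_variance : \sum_i pi i * f i ^+ 2 = q * (1 - q).
Proof.
have e i : pi i * f i ^+ 2 = (1 - q *+ 2) * (pi i * (B i)%:R) + q ^+ 2 * pi i.
  by case: (B i); rewrite /=; ring.
under eq_bigr do rewrite e.
by rewrite big_split /= -!mulr_sumr sum_indicator pi_sum1; ring.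
Qed.

(** The constant part of the centered indicator drops out by stationarity, which
    leaves the flow out of [B]. *)
Lemma centered_indicator_dirichlet :
  \sum_i pi i * f i ^+ 2 - \sum_i pi i * f i * (\sum_j P i j * f j) =
  \sum_(i | B i) pi i * \sum_(j | ~~ B j) P i j.
Proof.
have Pf i : \sum_j P i j * f j = \sum_j P i j * (B j)%:R - q.
  by under eq_bigr do rewrite mulrBr; rewrite sumrB -mulr_suml P_sum1 mul1r.
have stat : \sum_i pi i * (\sum_j P i j * (B j)%:R) = q.
  rewrite -sum_indicator; under eq_bigr do rewrite mulr_sumr.
  rewrite exchange_big; apply: eq_bigr => j _.
  under eq_bigr do rewrite mulrA P_rev -mulrA [P _ _ * _]mulrC mulrA.
  by rewrite -mulr_sumr P_sum1 mulr1.
rewrite -sumrB [RHS]big_mkcond /=.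
transitivity (\sum_i (pi i * (B i)%:R * (1 - \sum_j P i j * (B j)%:R)
    - q * (pi i * (B i)%:R) + q * (pi i * \sum_j P i j * (B j)%:R))).
  by apply: eq_bigr => i _; rewrite Pf; case: (B i); rewrite /=; ring.
rewrite big_split sumrB /= -!mulr_sumr stat sum_indicator subrK.
apply: eq_bigr => i _; case: (B i); rewrite /= ?mulr0 ?mul0r // mulr1.
congr (_ * _); rewrite -{1}(P_sum1 i) -sumrB [RHS]big_mkcond; apply: eq_bigr => j _.
by case: (B j); rewrite /= ?mulr1 ?mulr0 ?subrr ?subr0.
Qed.

Lemma conductance_bound (o : 'I_n) :
  (forall i j, 0 <= P i j) -> (forall i, 0 < pi i) -> (forall i, 0 < P i i) ->
  (forall i, connect [rel i j | 0 < P i j] i o) ->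
  second_eigenvalue P < 1 /\
  (1 - second_eigenvalue P) * (q * (1 - q)) <=
    \sum_(i | B i) pi i * \sum_(j | ~~ B j) P i j.
Proof.
move=> P_ge0 pi_gt0 P_diag P_conn.
have [gamma1 /(_ _ centered_indicator_mean)] :=
  spectral_gap P_ge0 P_sum1 pi_gt0 P_rev P_diag P_conn.
split=> //; rewrite -centered_indicator_dirichlet -centered_indicator_variance.
by rewrite mulrBl mul1r lerB.
Qed.
End Bottleneck.

(** * One step of the dynamics *)

Section Glauber.
Variables (R : realType) (b h : nat) (lambda omega : R).
Hypothesis lambda_gt0 : 0 < lambda.
Hypothesis omega_gt0 : 0 < omega.
Implicit Types (sigma tau rho : config b h) (u v : vertex b h).

Local Notation alpha := (@activity R b h lambda omega).
Local Notation p := (@occupy_prob R b h lambda omega).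
Local Notation w := (@weight R b h lambda omega).

Lemma activity_gt0 v : 0 < alpha v.
Proof. by rewrite /activity; case: ifP. Qed.

Lemma card_vertex_gt0 : (0 < #|vertex b h|)%N.
Proof. by apply/card_gt0P; exists (tree_root b h). Qed.

Lemma adj_irrefl v : adj v v = false.
Proof.
rewrite /adj /= orbb; apply/existsP => -[i /eqP /(congr1 size)] /=.
by move/eqP; rewrite eqn_leq ltnn andbF.
Qed.

Lemma adj_sym u v : adj u v = adj v u.
Proof. by rewrite /adj /= orbC. Qed.

Lemma set_at_id sigma v : set_at sigma v (sigma v) = sigma.
Proof. by apply/ffunP => u; rewrite ffunE; case: eqP => // ->. Qed.

Lemma set_at_twice sigma v x y : set_at (set_at sigma v x) v y = set_at sigma v y.
Proof. by apply/ffunP => u; rewrite !ffunE; case: eqP. Qed.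

(** Splits the outcome of an update into the value at [v] and agreement away from
    [v]; resetting both configurations to 0 at [v] expresses the latter as an
    equality of configurations. *)
Lemma eq_set_at sigma tau v x :
  (tau == set_at sigma v x) = (tau v == x) && (set_at tau v false == set_at sigma v false).
Proof.
apply/eqP/andP => [->|[/eqP <- /eqP e]].
  by rewrite set_at_twice eqxx ffunE eqxx.
by rewrite -(set_at_twice sigma v false) -e set_at_twice set_at_id.
Qed.

Lemma independentP sigma :
  reflect (forall u v, adj u v -> sigma u -> sigma v -> False) (independent sigma).
Proof.
apply: (iffP forallP) => [H u v uv su sv|H u].
  by move/forallP/(_ v): (H u); rewrite uv su sv.
by apply/forallP => v; apply/implyP => uv; apply/negP => /andP[]; apply: H.
Qed.

Lemma independent_set_false sigma v :
  independent sigma -> independent (set_at sigma v false).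
Proof.
move=> /independentP H; apply/independentP => u1 u2 a; rewrite !ffunE.
by case: eqP => // _; case: eqP => // _; apply: H.
Qed.

Lemma independent_set_true sigma v :
  independent sigma -> [forall u, adj u v ==> ~~ sigma u] ->
  independent (set_at sigma v true).
Proof.
move=> /independentP H /forallP nb; apply/independentP => u1 u2 a; rewrite !ffunE.
have [e1|_] := eqVneq u1 v; have [e2|_] := eqVneq u2 v.
- by move: a; rewrite e1 e2 adj_irrefl.
- by move: a; rewrite e1 adj_sym => a _ s2; move: (nb u2); rewrite a s2.
- by move: a; rewrite e2 => a s1 _; move: (nb u1); rewrite a s1.
- exact: H.
Qed.

Lemma occupied_free sigma v :
  independent sigma -> sigma v -> [forall u, adj u v ==> ~~ sigma u].
Proof.
move=> /independentP H sv; apply/forallP => u; apply/implyP => uv.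
by apply/negP => su; apply: (H u v).
Qed.

Lemma occupy_prob_ge0 sigma v : 0 <= p sigma v.
Proof.
rewrite /occupy_prob; case: ifP => // _.
by rewrite divr_ge0 ?addr_ge0 ?ltW ?activity_gt0.
Qed.

Lemma occupy_prob_lt1 sigma v : p sigma v < 1.
Proof.
rewrite /occupy_prob; case: ifP => // _.
by rewrite ltr_pdivrMr ?mul1r ?ltrDr // addr_gt0 ?activity_gt0.
Qed.

Lemma occupy_prob_gt0 sigma v : independent sigma -> sigma v -> 0 < p sigma v.
Proof.
move=> si sv; rewrite /occupy_prob occupied_free //.
by rewrite divr_gt0 ?addr_gt0 ?activity_gt0.
Qed.

(** The update at [v] looks only at the neighbours of [v], and [v] is not one of
    them. *)
Lemma occupy_prob_local sigma tau v :
  set_at tau v false = set_at sigma v false -> p tau v = p sigma v.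
Proof.
move=> e; rewrite /occupy_prob; congr (if _ then _ else _).
apply: eq_forallb => u; have [->|uv] := eqVneq u v; first by rewrite adj_irrefl.
by move/ffunP/(_ u): e; rewrite !ffunE (negbTE uv) => ->.
Qed.

Definition site_update v sigma tau : R :=
  p sigma v * (tau == set_at sigma v true)%:R +
  (1 - p sigma v) * (tau == set_at sigma v false)%:R.

Lemma glauberE sigma tau :
  glauber lambda omega sigma tau =
  #|vertex b h|%:R^-1 * \sum_v site_update v sigma tau.
Proof. by []. Qed.

Lemma site_updateE v sigma tau :
  site_update v sigma tau =
  (if tau v then p sigma v else 1 - p sigma v) *
  (set_at tau v false == set_at sigma v false)%:R.
Proof.
rewrite /site_update (eq_set_at _ _ _ true) (eq_set_at sigma tau v false).
by case: (tau v); case: (set_at tau v false == _); rewrite /= ?mulr0 ?mulr1 ?addr0 ?add0r.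
Qed.

Lemma site_update_ge0 v sigma tau : 0 <= site_update v sigma tau.
Proof.
rewrite site_updateE mulr_ge0 ?ler0n //.
by case: ifP => _; rewrite ?occupy_prob_ge0 // subr_ge0 ltW ?occupy_prob_lt1.
Qed.

Lemma site_update_neq0 v sigma tau :
  site_update v sigma tau != 0 -> tau = sigma \/ tau = flip sigma v.
Proof.
rewrite site_updateE.
have [e _|_] := eqVneq (set_at tau v false) (set_at sigma v false); last by rewrite mulr0 eqxx.
have tE : tau = set_at sigma v (tau v).
  by apply/eqP; rewrite eq_set_at eqxx e eqxx.
have [te|tne] := eqVneq (tau v) (sigma v); first by left; rewrite tE te set_at_id.
by right; rewrite /flip tE; congr set_at; case: (tau v) (sigma v) tne => [] [].
Qed.

Lemma sum_eq_indset rho :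
  \sum_(tau : indset b h) (val tau == rho)%:R = (independent rho)%:R :> R.
Proof.
have [ri|ri] := boolP (independent rho).
  rewrite (bigD1 (exist _ rho ri : indset b h)) //= eqxx big1 ?addr0 // => tau.
  by rewrite -val_eqE /= => /negbTE ->.
by rewrite big1 // => tau _; case: eqP => // e; move: (valP tau); rewrite e (negbTE ri).
Qed.

(** When occupying [v] would violate independence, the probability of doing so is
    0, so no mass leaves the independent sets. *)
Lemma site_update_sum1 v sigma : independent sigma ->
  \sum_(tau : indset b h) site_update v sigma (val tau) = 1.
Proof.
move=> si; rewrite big_split /= -!mulr_sumr !sum_eq_indset.
rewrite independent_set_false // mulr1.
have -> : p sigma v * (independent (set_at sigma v true))%:R = p sigma v.
  rewrite /occupy_prob; case: ifP => [fr|_]; last by rewrite mul0r.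
  by rewrite independent_set_true // mulr1.
by rewrite addrC subrK.
Qed.

Lemma weightE sigma : w sigma = \prod_v (if sigma v then alpha v else 1).
Proof.
rewrite /weight -!prodr_const big_mkcond [X in _ * X]big_mkcond -big_split; apply: eq_bigr => v _ /=.
by rewrite !inE /activity; case: (sigma v); case: (is_leaf v); rewrite ?mulr1 ?mul1r.
Qed.

Lemma weight_gt0 sigma : 0 < w sigma.
Proof. by rewrite weightE prodr_gt0 // => v _; case: ifP => // _; apply: activity_gt0. Qed.

Lemma weight_set_true sigma v :
  w (set_at sigma v true) = alpha v * w (set_at sigma v false).
Proof.
rewrite !weightE (bigD1 v) // [in RHS](bigD1 v) //= !ffunE eqxx mul1r.
by congr (_ * _); apply: eq_bigr => u uv; rewrite !ffunE (negbTE uv).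
Qed.

(** A heat-bath update resamples [v] from its conditional law: occupying [v]
    multiplies the weight by [alpha v], and the two outcomes have odds
    [alpha v : 1]. *)
Lemma site_update_reversible v sigma tau : independent sigma -> independent tau ->
  w sigma * site_update v sigma tau = w tau * site_update v tau sigma.
Proof.
move=> si ti; rewrite !site_updateE [in RHS]eq_sym.
case: eqP => [e|]; last by rewrite !mulr0.
have ptau := occupy_prob_local e; rewrite !mulr1 ptau.
have -> : w sigma = w (set_at sigma v (sigma v)) by rewrite set_at_id.
have -> : w tau = w (set_at sigma v (tau v)).
  by rewrite -{1}(set_at_id tau v) -(set_at_twice tau v false) e set_at_twice.
have a1 : 1 + alpha v != 0 by rewrite gt_eqF // addr_gt0 ?activity_gt0.
case sv : (sigma v); case tv : (tau v) => //; rewrite weight_set_true.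
- by rewrite /occupy_prob occupied_free //; field.
- by rewrite -ptau /occupy_prob occupied_free //; field.
Qed.

Lemma glauber_gt0 v sigma tau : 0 < site_update v sigma tau ->
  0 < glauber lambda omega sigma tau.
Proof.
move=> K0; rewrite glauberE mulr_gt0 ?invr_gt0 ?ltr0n ?card_vertex_gt0 //.
rewrite (bigD1 v) //= ltr_wpDr // sumr_ge0 // => u _; exact: site_update_ge0.
Qed.

Lemma glauber_refl_gt0 sigma : independent sigma -> 0 < glauber lambda omega sigma sigma.
Proof.
move=> si; apply: (@glauber_gt0 (tree_root b h)); rewrite site_updateE eqxx mulr1.
by case: ifP => [/(occupy_prob_gt0 si)|_] //; rewrite subr_gt0 occupy_prob_lt1.
Qed.

Lemma glauber_remove_gt0 sigma v : 0 < glauber lambda omega sigma (set_at sigma v false).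
Proof.
apply: (@glauber_gt0 v); rewrite site_updateE set_at_twice eqxx mulr1 ffunE eqxx.
by rewrite subr_gt0 occupy_prob_lt1.
Qed.
End Glauber.

(** * The transition matrix on independent sets *)

Definition accept_prob (R : realType) (b h : nat) (lambda omega : R)
    (A : reconstruction b) : R :=
  nu_prob lambda omega [pred sigma : config b h | A h (leaf_restrict sigma)].

Section GlauberMatrix.
Variables (R : realType) (b h : nat) (lambda omega : R).
Hypothesis lambda_gt0 : 0 < lambda.
Hypothesis omega_gt0 : 0 < omega.

Local Notation M := (glauber_mx b h lambda omega).
Local Notation state := 'I_#|indset b h|.
Local Notation nu := (@nu R b h lambda omega).

Lemma sum_over_states (F : indset b h -> R) (B : pred (indset b h)) :
  \sum_(i : state | B (enum_val i)) F (enum_val i) = \sum_(tau | B tau) F tau.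
Proof.
by rewrite [RHS](reindex _ (onW_bij _ (@enum_val_bij (indset b h)))).
Qed.

Lemma independent_empty : independent ([ffun=> false] : config b h).
Proof. by apply/independentP => u v _; rewrite ffunE. Qed.

Definition empty_indset : indset b h := 
  exist (fun sigma : config b h => independent sigma) _ independent_empty.

Lemma partition_function_gt0 :
  0 < \sum_(tau : indset b h) weight lambda omega (val tau).
Proof.
rewrite (bigD1 empty_indset) //= ltr_wpDr ?weight_gt0 //.
by rewrite sumr_ge0 // => tau _; rewrite ltW // weight_gt0.
Qed.

Lemma nu_gt0 sigma : 0 < nu sigma.
Proof. by rewrite divr_gt0 ?weight_gt0 ?partition_function_gt0. Qed.

Lemma nu_sum1 : \sum_sigma nu sigma = 1.
Proof. by rewrite -mulr_suml divff // gt_eqF // partition_function_gt0. Qed.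

Lemma glauber_mx_ge0 (i j : state) : 0 <= M i j.
Proof.
rewrite mxE glauberE mulr_ge0 ?invr_ge0 ?ler0n // sumr_ge0 // => v _.
exact: site_update_ge0.
Qed.

Lemma glauber_mx_sum1 (i : state) : \sum_j M i j = 1.
Proof.
under eq_bigr do rewrite mxE.
rewrite (sum_over_states (fun tau => glauber lambda omega (val (enum_val i)) (val tau)) xpredT).
rewrite -mulr_sumr exchange_big /=.
under eq_bigr do rewrite (site_update_sum1 _ _ _ (valP (enum_val i))).
by rewrite sumr_const mulVf // pnatr_eq0 -lt0n card_vertex_gt0.
Qed.

Lemma glauber_mx_reversible (i j : state) :
  nu (enum_val i) * M i j = nu (enum_val j) * M j i.
Proof.
rewrite !mxE !glauberE ![nu _ * _]mulrCA; congr (_ * _).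
rewrite !mulr_sumr; apply: eq_bigr => v _.
rewrite /Defs.nu mulrAC [RHS]mulrAC; congr (_ / _).
apply: site_update_reversible => //; exact: valP.
Qed.

(** An independent set is emptied one vertex at a time. *)
Lemma glauber_mx_connected (i : state) :
  connect [rel i j | 0 < M i j] i (enum_rank empty_indset).
Proof.
have [m] := ubnP #|[pred v | val (enum_val i) v]|.
elim: m i => // m IH i im.
have [v sv|none] := pickP (fun v => val (enum_val i) v); last first.
  suff -> : i = enum_rank empty_indset by exact: connect0.
  apply: enum_val_inj; rewrite enum_rankK; apply/val_inj/ffunP => v.
  by rewrite none ffunE.
pose tau : indset b h := exist (fun sigma : config b h => independent sigma) _
  (independent_set_false v (valP (enum_val i))).
apply: (@connect_trans _ _ (enum_rank tau)).
  by apply: connect1; rewrite /= mxE enum_rankK glauber_remove_gt0.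
apply: IH; rewrite enum_rankK; rewrite ltnS in im; apply: leq_trans im.
apply: proper_card; apply/properP; split.
  by apply/fintype.subsetP => u; rewrite !inE /= ffunE; case: eqP.
by exists v; rewrite inE //= ffunE eqxx.
Qed.

(** * Leaving the acceptance event *)

Section Acceptance.
Variable A : reconstruction b.
Local Notation a sigma := (@A h (leaf_restrict sigma)).

(** A single-site update leaves the acceptance event only when it flips a leaf
    to which the algorithm is sensitive; the probability that such an update
    really flips its leaf is bounded by 1. *)
Lemma escape_le_sensitivity (sigma : indset b h) : a (val sigma) ->
  \sum_(tau : indset b h | ~~ a (val tau)) glauber lambda omega (val sigma) (val tau)
    <= sensitivity R A (val sigma).
Proof.
move=> as1; rewrite -mulr_sumr exchange_big /= /sensitivity mulrC.
rewrite ler_wpM2r ?invr_ge0 ?ler0n // -sum1_card natr_sum [leRHS]big_mkcond /=.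
apply: ler_sum => v _; rewrite inE.
have [_|stay] := ifPn.
  apply: (@le_trans _ _ (\sum_(tau : indset b h) site_update lambda omega v (val sigma) (val tau)));
    last by rewrite site_update_sum1 //; apply: valP.
  rewrite [leRHS](bigID (fun tau : indset b h => a (val tau))) /= lerDr sumr_ge0 // => tau _.
  exact: site_update_ge0.
rewrite big1 // => tau at0; apply/eqP/negPn/negP => /site_update_neq0[e|e].
  by move: at0; rewrite e as1.
move: stay at0; rewrite e negb_and negbK => /orP[nleaf|/eqP ->]; last by rewrite as1.
suff -> : leaf_restrict (flip (val sigma) v) = leaf_restrict (val sigma) by rewrite as1.
apply/ffunP => u; rewrite !ffunE; case: eqP => // uv.
by move: nleaf; rewrite -uv (valP u).
Qed.

Lemma gap_le_sensitivity :
  let q := accept_prob h lambda omega A in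
  second_eigenvalue M < 1 /\
  (1 - second_eigenvalue M) * (q * (1 - q)) <= average_sensitivity h lambda omega A.
Proof.
move=> q; pose B (i : state) := a (val (enum_val i)).
have qE : q = \sum_(i | B i) nu (enum_val i).
  by rewrite (sum_over_states nu (fun tau => a (val tau))).
have [] := @conductance_bound R _ M (fun i => nu (enum_val i)) glauber_mx_sum1 _
  glauber_mx_reversible B (enum_rank empty_indset) glauber_mx_ge0 _ _ glauber_mx_connected.
- by rewrite (sum_over_states nu xpredT) nu_sum1.
- by move=> i; apply: nu_gt0.
- by move=> i; rewrite mxE; apply: glauber_refl_gt0 => //; apply: valP.
rewrite -qE => g1 gq; split=> //; apply: le_trans gq _.
pose esc (sigma : indset b h) :=
  \sum_(tau : indset b h | ~~ a (val tau)) glauber lambda omega (val sigma) (val tau).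
have -> : \sum_(i | B i) nu (enum_val i) * (\sum_(j | ~~ B j) M i j) =
          \sum_(sigma : indset b h | a (val sigma)) nu sigma * esc sigma.
  rewrite -(sum_over_states (fun sigma => nu sigma * esc sigma) (fun tau => a (val tau))).
  apply: eq_bigr => i _; congr (_ * _); rewrite /esc -sum_over_states.
  by apply: eq_bigr => j _; rewrite mxE.
rewrite big_mkcond; apply: ler_sum => sigma _.
case: ifP => [as1|_]; last by rewrite !mulr0.
by rewrite mulr1 ler_wpM2l ?escape_le_sensitivity // ltW ?nu_gt0.
Qed.
End Acceptance.
End GlauberMatrix.

(** * Effectiveness *)

Lemma effective_eventually (R : realType) (b : nat) (lambda omega : R)
    (A : reconstruction b) : effective lambda omega A ->
  exists2 c : R, 0 < c & \forall h \near \oo, c <= effectiveness h lambda omega A.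
Proof.
case=> c0 c0_gt0; set u := fun h : nat => _ => uE.
exists (c0 / 2); first by rewrite divr_gt0.
have : ((c0 / 2)%:E < ereal_sup (range (einfs u)))%E.
  have <- : limn (einfs u) = ereal_sup (range (einfs u)).
    by apply/cvg_lim => //; apply: cvg_einfs_sup.
  by rewrite -limn_einf_lim uE lte_fin ltr_pdivrMr // mulr_natr mulr2n ltrDl.
case/ereal_sup_gt => _ [N _ <-] cN.
exists N => // h Nh /=; rewrite -lee_fin (le_trans (ltW cN)) //.
by apply: ereal_inf_lbound; exists h.
Qed.

Lemma correlation_le_prob (R : realType) (b h : nat) (lambda omega : R)
    (A : reconstruction b) (x : bool) : 0 < lambda -> 0 < omega ->
  correlation h lambda omega A x <=
  nu_prob lambda omega [pred sigma : config b h | A h (leaf_restrict sigma) == x].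
Proof.
move=> l0 o0; have nu0 (sigma : indset b h) : 0 <= nu lambda omega sigma.
  by rewrite ltW // nu_gt0.
rewrite /correlation lerBlDr (@le_trans _ _ (nu_prob lambda omega
  [pred sigma : config b h | A h (leaf_restrict sigma) == x])) //; last first.
  by rewrite lerDl mulr_ge0 // sumr_ge0.
rewrite /nu_prob [leRHS](bigID (fun sigma : indset b h => val sigma (tree_root b h) == x)) /=.
by rewrite lerDl sumr_ge0.
Qed.

(** The two halves of the minimum bound the probabilities of the answers 1 and 0
    separately. *)
Lemma effectiveness_variance (R : realType) (b h : nat) (lambda omega c : R)
    (A : reconstruction b) : 0 < lambda -> 0 < omega -> 0 < c ->
  c <= effectiveness h lambda omega A ->
  c ^+ 2 <= accept_prob h lambda omega A * (1 - accept_prob h lambda omega A).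
Proof.
move=> l0 o0 c0; rewrite /effectiveness le_min => /andP[cf ct].
set q := accept_prob h lambda omega A.
have qT : nu_prob lambda omega
    [pred sigma : config b h | A h (leaf_restrict sigma) == true] = q.
  by apply: eq_bigl => sigma /=; rewrite eqb_id.
have qF : nu_prob lambda omega
    [pred sigma : config b h | A h (leaf_restrict sigma) == false] = 1 - q.
  rewrite -(nu_sum1 b h l0 o0) (bigID (fun sigma : indset b h => A h (leaf_restrict (val sigma)))) /=.
  by rewrite addrC addrK; apply: eq_bigl => sigma /=; rewrite eqbF_neg.
have := le_trans cf (correlation_le_prob h A false l0 o0).
have := le_trans ct (correlation_le_prob h A true l0 o0).
rewrite qT qF expr2 => cq cq'.
by apply: ler_pM; rewrite ?(ltW c0).
Qed.

Theorem theorem4 (R : realType) (b : nat) (omega lambda : R)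
    (hb : (2 <= b)%N) (homega : 0 < omega)
    (hlambda : lambda = omega * (1 + omega) ^+ b)
    (A : reconstruction b) (hA : effective lambda omega A) :
  (\forall h \near \oo, 0 < average_sensitivity h lambda omega A) /\
  (fun h : nat => relaxation_time b h lambda omega) \is
    'Omega_\oo (fun h : nat => (average_sensitivity h lambda omega A)^-1).
Proof.
have lambda_gt0 : 0 < lambda by rewrite hlambda mulr_gt0 // exprn_gt0 // addr_gt0.
have [c c_gt0 c_eff] := effective_eventually hA.
have gap_sens h : c <= effectiveness h lambda omega A ->
    second_eigenvalue (glauber_mx b h lambda omega) < 1 /\
    (1 - second_eigenvalue (glauber_mx b h lambda omega)) * c ^+ 2 <=
      average_sensitivity h lambda omega A.
  move=> ch; have [g1 gS] := gap_le_sensitivity h lambda_gt0 homega A.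
  split=> //; apply: le_trans gS; apply: ler_wpM2l; first by rewrite subr_ge0 ltW.
  exact: effectiveness_variance.
have sens_gt0 h : c <= effectiveness h lambda omega A ->
    0 < average_sensitivity h lambda omega A.
  move=> /gap_sens[g1]; apply: lt_le_trans.
  by rewrite mulr_gt0 ?subr_gt0 ?exprn_gt0.
split; first by apply: filterS c_eff.
rewrite qualifE; apply/asboolP; exists (c ^+ 2); first by rewrite exprn_gt0.
apply: filterS c_eff => h ch; have [g1 gS] := gap_sens h ch.
have S0 := sens_gt0 h ch; rewrite /relaxation_time.
rewrite (gtr0_norm (_ : 0 < (_)^-1)) ?invr_gt0 // [leRHS]gtr0_norm ?invr_gt0 ?subr_gt0 //.
by rewrite ler_pdivrMr // mulrC ler_pdivlMr ?subr_gt0 // mulrC.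
Qed.
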